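(* Let $\mathbf{D}$ be a totally ordered divisible Abelian $\ell$-group and let $\varphi=\forall x_1\dots x_n\exists! z_1\dots z_m\,\alpha(\bar x,\bar z)$ be an EFD-sentence that holds in $\mathbf{D}$. Then the functions $[\varphi]_1^\mathbf{D},\dots,[\varphi]_m^\mathbf{D}$ defined by $\varphi$ on $\mathbf{D}$ are term-functions of $\overline{\mathbf{D}}$.
   Context: Abelian $\ell$-groups are algebras in the language $\{+,-,0,\vee,\wedge\}$ where $(A,+,-,0)$ is an Abelian group, $(A,\vee,\wedge)$ a lattice and $a+(b\vee c)=(a+b)\vee(a+c)$. An $\ell$-group $\mathbf G$ is divisible if for every $g\in G$ and positive integer $n$ there is $h\in G$ with $nh=g$. An EFD-sentence is a sentence $\forall x_1\dots x_n\exists! z_1\dots z_m\bigwedge_{i=1}^k s_i(\bar x,\bar z)=t_i(\bar x,\bar z)$ with terms $s_i,t_i$, $n\ge0$, $m\ge1$; if it holds in $\mathbf A$, the system defines a function $F:A^n\to A^m$, whose coordinate functions are denoted $[\varphi]_1^\mathbf A,\dots,[\varphi]_m^\mathbf A$. For each positive integer $k$, $\delta_k:=\forall x\exists! z\,kz=x$; for a divisible $\mathbf D$ (which satisfies all $\delta_k$, $\ell$-groups being torsion-free), $\overline{\mathbf D}:=(\mathbf D,([\delta_k]^\mathbf D)_{k\ge1})$ is $\mathbf D$ expanded by all the division operations $x\mapsto x/k$. *)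

(* Defs.v *)
From HB Require Import structures.
From mathcomp Require Import all_boot all_order ssralg orderedzmod.

Set Implicit Arguments.
Unset Strict Implicit.
Unset Printing Implicit Defensive.

Import Order.TTheory GRing.Theory.
Local Open Scope ring_scope.

(* Only orderedzmod is loaded from the numeric hierarchy: realDomainType would be
   a second join of Zmodule and Lattice, and Hierarchy-Builder requires
   AbelianLGroup to be declared before it. *)
HB.mixin Record isAbelianLGroup A of Order.Lattice ring_display A
    & GRing.Zmodule A := {
  addrUr : forall a b c : A,
    a + Order.join b c = Order.join (a + b) (a + c)
}.

#[short(type="lgroupType")]
HB.structure Definition AbelianLGroup :=
  { A of isAbelianLGroup A & Order.Lattice ring_display A & GRing.Zmodule A }.

Definition divisible (A : lgroupType) : Prop :=
  forall (g : A) (n : nat), (0 < n)%N -> exists h : A, h *+ n = g.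

Definition totally_ordered (A : lgroupType) : Prop :=
  forall a b : A, (a <= b) || (b <= a).

(* Terms with variables in V, in the language of l-groups extended by a family
   F of unary operation symbols. *)
Inductive term (F V : Type) : Type :=
| TVar of V
| TZero
| TOpp of term F V
| TAdd of term F V & term F V
| TJoin of term F V & term F V
| TMeet of term F V & term F V
| TFun of F & term F V.

Arguments TVar {F V}.
Arguments TZero {F V}.

Fixpoint eval (A : lgroupType) (F V : Type) (I : F -> A -> A) (v : V -> A)
    (t : term F V) : A :=
  match t with
  | TVar x => v x
  | TZero => 0
  | TOpp t => - eval I v t
  | TAdd t u => eval I v t + eval I v u
  | TJoin t u => Order.join (eval I v t) (eval I v u)
  | TMeet t u => Order.meet (eval I v t) (eval I v u)
  | TFun f t => I f (eval I v t)
  end.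

Definition lterm (V : Type) : Type := term void V.

Definition leval (A : lgroupType) (V : Type) (v : V -> A) (t : lterm V) : A :=
  eval (fun f : void => of_void (A -> A) f) v t.

(* The sentence forall x_1 .. x_n, exists! z_1 .. z_m, /\_i s_i = t_i is given
   by the list of its equations (s_i, t_i); inl i is the variable x_i and
   inr j is the variable z_j. *)
Definition efd (n m : nat) : Type :=
  seq (lterm ('I_n + 'I_m) * lterm ('I_n + 'I_m)).

Section Efd.
Variables (A : lgroupType) (n m : nat) (phi : efd n m).

Definition efd_env (x : {ffun 'I_n -> A}) (z : {ffun 'I_m -> A})
    (w : 'I_n + 'I_m) : A :=
  match w with inl i => x i | inr j => z j end.

Definition efd_sat (x : {ffun 'I_n -> A}) (z : {ffun 'I_m -> A}) : bool :=
  all (fun e => leval (efd_env x z) e.1 == leval (efd_env x z) e.2) phi.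

Definition efd_holds : Prop :=
  forall x : {ffun 'I_n -> A}, exists! z : {ffun 'I_m -> A}, efd_sat x z.

Lemma efd_holds_ex : efd_holds -> forall x, exists z, efd_sat x z.
Proof. by move=> h x; have [z [hz _]] := h x; exists z. Qed.

Definition efd_fun (h : efd_holds) (x : {ffun 'I_n -> A}) : {ffun 'I_m -> A} :=
  xchoose (efd_holds_ex h x).

Definition efd_coord (h : efd_holds) (i : 'I_m) (x : {ffun 'I_n -> A}) : A :=
  efd_fun h x i.

Lemma efd_funP (h : efd_holds) x z : efd_sat x z <-> efd_fun h x = z.
Proof.
have hx := xchooseP (efd_holds_ex h x).
split=> [hz|<- //]; have [z0 [_ u]] := h x.
by rewrite -(u _ hz) /efd_fun -(u _ hx).
Qed.

End Efd.

Definition posnat : Type := {k : nat | (0 < k)%N}.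

Definition delta (k : nat) : efd 1 1 :=
  [:: (iterop k (@TAdd _ _) (TVar (inr ord0)) TZero, TVar (inl ord0))].

Section Division.
Variable A : lgroupType.
Implicit Types (a b c : A) (k : nat).

Lemma delta_sat k (x z : {ffun 'I_1 -> A}) :
  efd_sat (delta k) x z = (z ord0 *+ k == x ord0).
Proof.
rewrite /efd_sat /delta /= andbT; congr (_ == _).
case: k => // k; rewrite GRing.mulrS; elim: k => [|k IH].
  by rewrite mulr0n addr0.
rewrite GRing.mulrS -IH //=.
Qed.

Lemma lgroup_le_add a b c : b <= c -> a + b <= a + c.
Proof. by move=> /join_idPl bc; apply/join_idPl; rewrite -addrUr bc. Qed.

Lemma lgroup_mulrn_le0 k a : (0 < k)%N -> a *+ k <= 0 -> a <= 0.
Proof.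
case: k => // k _ ak0.
pose fix c j := if j is j'.+1 then Order.join (c j') (a *+ j) else 0.
have c0 j : 0 <= c j by elim: j => //= j /le_trans; apply; rewrite leUl.
have ca j : a + c j <= Order.join (c j) (a *+ j.+1).
  elim: j => [|j IH]; first by rewrite /= addr0 leUr.
  by rewrite /= addrUr -!GRing.mulrS leUx (le_trans IH) ?leUl //= leUr.
have : a + c k <= c k.
  by apply: le_trans (ca k) _; rewrite leUx lexx /= (le_trans ak0).
by move=> /(lgroup_le_add (- c k)); rewrite addrCA addNr addr0.
Qed.

Lemma lgroup_torsion_free k a : (0 < k)%N -> a *+ k = 0 -> a = 0.
Proof.
move=> k0 ak; apply/le_anti; rewrite (@lgroup_mulrn_le0 k) ?ak //=.
have /(lgroup_le_add a) : - a <= 0.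
  by apply: (@lgroup_mulrn_le0 k) => //; rewrite mulNrn ak oppr0.
by rewrite subrr addr0.
Qed.

Lemma delta_holds (hA : divisible A) (k : posnat) :
  efd_holds A (delta (val k)).
Proof.
case: k => k k0 /= x; have [h hx] := hA (x ord0) k k0.
exists [ffun=> h]; split=> [|z]; rewrite delta_sat ?ffunE ?hx // => /eqP zx.
apply/ffunP=> i; rewrite ffunE (ord1 i); apply/eqP; rewrite -subr_eq0.
by apply/eqP/(lgroup_torsion_free k0); rewrite mulrnBl zx hx subrr.
Qed.

Definition div_op (hA : divisible A) (k : posnat) (a : A) : A :=
  efd_coord (delta_holds hA k) ord0 [ffun=> a].

Lemma div_opK (hA : divisible A) (k : posnat) a : div_op hA k a *+ val k = a.
Proof.
have := (efd_funP (delta_holds hA k) [ffun=> a] _).2 erefl.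
by rewrite delta_sat ffunE => /eqP.
Qed.

(* f is a term-function of A expanded by all the division operations. *)
Definition division_term_function (hA : divisible A) (n : nat)
    (f : {ffun 'I_n -> A} -> A) : Prop :=
  exists t : term posnat 'I_n,
    forall x : {ffun 'I_n -> A}, f x = eval (div_op hA) x t.

End Division.

(* Main.v *)
(* The system is a finite union of closed cones cut out by rational linear forms
   in (x, z), since each l-group term is linear on finitely many such cones.
   Eliminating variables one at a time, any point of D can be replaced by a
   rational point at which finitely many given forms have the same signs; thus
   (if D is nontrivial) the cones also define a function over the rationals.
   There, uniqueness
   forces the constraints active at a solution to determine z, which leaves
   finitely many linear pieces. For any two points x and y some piece lies below
   the function at x and above it at y; hence the i-th coordinate is the maximum,
   over the sets K of pieces that never lie entirely above it, of the minimum
   of K.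
   This is again a sign condition and is transferred back to D. *)
Require Import Defs.
From mathcomp Require Import all_boot all_order all_algebra.
From Stdlib Require Import Classical.
From mathcomp Require Import ring lra.

Set Implicit Arguments.
Unset Strict Implicit.
Unset Printing Implicit Defensive.

Import Order.TTheory GRing.Theory Num.Theory.
Local Open Scope ring_scope.

(** * Order and multiples in Abelian l-groups *)

Section LGroupOrder.
Variable A : lgroupType.
Implicit Types a b c : A.

Lemma lgroup_subr_ge0 a b : (0 <= b - a) = (a <= b).
Proof.
apply/idP/idP => [|/(@lgroup_le_add _ (- a))]; last by rewrite addNr addrC.
by move=> /(@lgroup_le_add _ a); rewrite addr0 addrC subrK.
Qed.

Lemma lgroup_oppr_ge0 a : (0 <= - a) = (a <= 0).
Proof. by rewrite -(lgroup_subr_ge0 a 0) sub0r. Qed.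

Lemma lgroup_mulrn_ge0 a k : (0 < k)%N -> (0 <= a *+ k) = (0 <= a).
Proof.
move=> k0; apply/idP/idP => [|a0].
  by rewrite -[_ *+ _]opprK -mulNrn lgroup_oppr_ge0 -[X in _ -> 0 <= X]opprK
     lgroup_oppr_ge0 => /lgroup_mulrn_le0; apply.
elim: k {k0} => // k IH; apply: le_trans IH _.
by rewrite -lgroup_subr_ge0 mulrSr addrAC subrr add0r.
Qed.


End LGroupOrder.

(** * Divisible l-groups as vector spaces over the rationals *)

Section RationalScaling.
Variables (A : lgroupType) (Adiv : divisible A).
Implicit Types (a b c : A) (p q : rat).

Lemma absz_denq_gt0 q : (0 < `|denq q|)%N.
Proof. by rewrite absz_gt0 denq_neq0. Qed.

(** Integer multiple first, then one division symbol: in this form scaling is directly expressible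
    by a term of the expansion. *)
Definition qscale q a : A :=
  div_op Adiv (exist _ `|denq q|%N (absz_denq_gt0 q)) (a *~ numq q).

Lemma qscaleP q a : qscale q a *+ `|denq q| = a *~ numq q.
Proof. exact: div_opK. Qed.

Lemma mul_denq_numq q : q * `|denq q|%:R = (numq q)%:~R.
Proof. by rewrite numqE pmulrn absz_denq. Qed.

(** Clear both denominators and use torsion-freeness. The fraction [j / k] need not be reduced, so
    each module law below follows by choosing a convenient common denominator. *)
Lemma qscale_uniq q (k : nat) (j : int) a b : (0 < k)%N ->
  q * k%:R = j%:~R -> b *+ k = a *~ j -> b = qscale q a.
Proof.
move=> k0 qk bk; apply/eqP; rewrite -subr_eq0; apply/eqP.
have dk0 : (0 < k * `|denq q|)%N by rewrite muln_gt0 k0 absz_denq_gt0.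
apply: (lgroup_torsion_free dk0); rewrite mulrnBl mulrnA bk mulnC mulrnA qscaleP.
rewrite !pmulrn -!mulrzA; apply/eqP; rewrite subr_eq0; apply/eqP; congr (a *~ _).
by apply/(@intr_inj rat); rewrite !intrM -qk -mul_denq_numq !pmulrn; ring.
Qed.

Lemma qscale1 a : qscale 1 a = a.
Proof. by apply/esym/(@qscale_uniq _ 1 1); rewrite ?mulr1. Qed.

Lemma qscale0l a : qscale 0 a = 0.
Proof. by apply/esym/(@qscale_uniq _ 1 0); rewrite ?mul0r ?mulr0z. Qed.

Lemma qscale0r q : qscale q 0 = 0.
Proof.
apply/esym/(@qscale_uniq _ _ (numq q) _ _ (absz_denq_gt0 q)).
  exact: mul_denq_numq.
by rewrite mul0rn mul0rz.
Qed.

Lemma qscaleDl p q a : qscale (p + q) a = qscale p a + qscale q a.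
Proof.
apply/esym/(@qscale_uniq _ (`|denq p| * `|denq q|)
  (numq p * `|denq q|%N + numq q * `|denq p|%N)).
- by rewrite muln_gt0 !absz_denq_gt0.
- by rewrite intrD !intrM -!mul_denq_numq natrM !pmulrn; ring.
rewrite mulrnDl mulrnA qscaleP mulnC mulrnA qscaleP mulrzDr !pmulrn.
by rewrite -!mulrzA.
Qed.

Lemma qscaleDr q a b : qscale q (a + b) = qscale q a + qscale q b.
Proof.
apply/esym/(@qscale_uniq _ _ (numq q) _ _ (absz_denq_gt0 q)).
  exact: mul_denq_numq.
by rewrite mulrnDl !qscaleP mulrzDl.
Qed.

Lemma qscaleA p q a : qscale p (qscale q a) = qscale (p * q) a.
Proof.
apply/(@qscale_uniq _ (`|denq p| * `|denq q|) (numq q * numq p)).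
- by rewrite muln_gt0 !absz_denq_gt0.
- by rewrite intrM -!mul_denq_numq natrM; ring.
by rewrite mulrnA qscaleP pmulrn mulrzAC -pmulrn qscaleP mulrzA.
Qed.

Lemma qscaleNl q a : qscale (- q) a = - qscale q a.
Proof. by apply/eqP; rewrite -addr_eq0 -qscaleDl addNr qscale0l. Qed.

Lemma qscale_ge0 q a : 0 < q -> (0 <= qscale q a) = (0 <= a).
Proof.
move=> q0; rewrite -(lgroup_mulrn_ge0 _ (absz_denq_gt0 q)) qscaleP.
have : 0 < numq q by rewrite numq_gt0.
by case: (numq q) => // k k0; rewrite -pmulrn lgroup_mulrn_ge0.
Qed.

Lemma qscaleNr q a : qscale q (- a) = - qscale q a.
Proof. by apply/eqP; rewrite -addr_eq0 -qscaleDr addNr qscale0r. Qed.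

Lemma qscale_le0 q a : 0 < q -> (qscale q a <= 0) = (a <= 0).
Proof. by move=> q0; rewrite -!lgroup_oppr_ge0 -qscaleNr qscale_ge0. Qed.

Lemma qscale_nge0 q a : q < 0 -> (0 <= qscale q a) = (a <= 0).
Proof.
by move=> q0; rewrite -[q]opprK qscaleNl lgroup_oppr_ge0 qscale_le0 ?oppr_gt0.
Qed.

Lemma qscale_nle0 q a : q < 0 -> (qscale q a <= 0) = (0 <= a).
Proof.
move=> q0; rewrite -lgroup_oppr_ge0 -qscaleNl qscale_ge0 ?oppr_gt0 //.
Qed.

End RationalScaling.

(** * Rational linear forms evaluated in the group *)

Section LinearForms.
Variables (A : lgroupType) (Adiv : divisible A) (V : finType).
Implicit Types (F G : {ffun V -> rat}) (v : V -> A) (q : rat).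

Definition lin_eval v F : A := \sum_w qscale Adiv (F w) (v w).

Lemma lin_evalD v F G : lin_eval v (F + G) = lin_eval v F + lin_eval v G.
Proof.
by rewrite -big_split; apply: eq_bigr => w _; rewrite ffunE qscaleDl.
Qed.

Lemma lin_evalN v F : lin_eval v (- F) = - lin_eval v F.
Proof.
by rewrite -sumrN; apply: eq_bigr => w _; rewrite ffunE qscaleNl.
Qed.

Lemma lin_eval0 v : lin_eval v 0 = 0.
Proof. by rewrite /lin_eval big1 // => w _; rewrite ffunE qscale0l. Qed.

Lemma lin_eval_scale v q F :
  lin_eval v [ffun w => q * F w] = qscale Adiv q (lin_eval v F).
Proof.
rewrite /lin_eval (big_morph (qscale Adiv q) (qscaleDr _ _) (qscale0r _ _)).
by apply: eq_bigr => w _; rewrite ffunE qscaleA.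
Qed.

Lemma lin_eval_var v w : lin_eval v [ffun u => (u == w)%:R] = v w.
Proof.
rewrite /lin_eval (bigD1 w) //= ffunE eqxx qscale1 big1 ?addr0 // => u /negPf uw.
by rewrite ffunE uw qscale0l.
Qed.

End LinearForms.

(** * Rational linear forms evaluated over the rationals *)

Section RationalForms.
Variable V : finType.
Implicit Types (F G : {ffun V -> rat}) (v : V -> rat) (q : rat).

Definition rat_eval v F : rat := \sum_w F w * v w.

Lemma rat_evalD v F G : rat_eval v (F + G) = rat_eval v F + rat_eval v G.
Proof.
by rewrite -big_split; apply: eq_bigr => w _; rewrite ffunE mulrDl.
Qed.

Lemma rat_evalN v F : rat_eval v (- F) = - rat_eval v F.
Proof. by rewrite -sumrN; apply: eq_bigr => w _; rewrite ffunE mulNr. Qed.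

Lemma rat_eval0 v : rat_eval v 0 = 0.
Proof. by rewrite /rat_eval big1 // => w _; rewrite ffunE mul0r. Qed.

Lemma rat_eval_scale v q F : rat_eval v [ffun w => q * F w] = q * rat_eval v F.
Proof. by rewrite mulr_sumr; apply: eq_bigr => w _; rewrite ffunE mulrA. Qed.

Lemma rat_eval_var v w : rat_eval v [ffun u => (u == w)%:R] = v w.
Proof.
rewrite /rat_eval (bigD1 w) //= ffunE eqxx mul1r big1 ?addr0 // => u /negPf uw.
by rewrite ffunE uw mul0r.
Qed.

Definition upd v a b u := if u == a then b else v u.

Lemma rat_eval_upd v a b F : F a = 0 -> rat_eval (upd v a b) F = rat_eval v F.
Proof.
move=> Fa; apply: eq_bigr => w _; rewrite /upd.
by case: eqP => // ->; rewrite Fa !mul0r.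
Qed.

(** The threshold of [F]: the value of the variable [a] at which [F] vanishes. If [F a = 0],
    division by zero makes it the zero form. *)
Definition solve_for a F : {ffun V -> rat} :=
  [ffun u => if u == a then 0 else - F u / F a].

Lemma solve_forE a F : F a != 0 ->
  F = [ffun u => F a * ([ffun w => (w == a)%:R] - solve_for a F) u].
Proof.
move=> Fa; apply/ffunP => u; rewrite !ffunE; case: eqP => [->|_].
  by rewrite subr0 mulr1.
by rewrite add0r mulNr opprK mulrC divfK.
Qed.

End RationalForms.

(** * Placing a rational among finitely many bounds *)

Lemma rat_above (x : rat) (h : seq rat) : (forall y, y \in h -> x < y) ->
  exists2 b, x < b & forall y, y \in h -> b < y.
Proof.
elim: h => [|y h IH] xh; first by exists (x + 1) => //; lra.
have [z zh|b xb bh] := IH; first by apply: xh; rewrite inE zh orbT.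
have xy : x < y by apply: xh; rewrite inE eqxx.
have [by_|yb] := ltP b y.
  by exists b => // z; rewrite inE => /orP[/eqP->//|/bh].
exists ((x + y) / 2%:R); first by lra.
move=> z; rewrite inE => /orP[/eqP->|/bh]; lra.
Qed.

(** Induction on [l]: if the point found for the tail does not exceed the new [x], it is replaced by
    one just above [x] and still below [h]. *)
Lemma rat_between (l h : seq rat) :
  (forall x y, x \in l -> y \in h -> x < y) ->
  exists b, (forall x, x \in l -> x < b) /\ (forall y, y \in h -> b < y).
Proof.
elim: l => [|x l IH] lh.
  suff [b bh] : exists b, forall y, y \in h -> b < y by exists b.
  elim: h {lh} => [|y h [b IH]]; first by exists 0.
  exists (Num.min b (y - 1)) => z; rewrite inE gt_min.
  by move=> /orP[/eqP->|/IH->//]; apply/orP; right; lra.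
have [y z yl zh|b [lb bh]] := IH.
  by apply: lh => //; rewrite inE yl orbT.
have [xb|bx] := ltP x b.
  by exists b; split=> // z; rewrite inE => /orP[/eqP->|/lb].
have [y yh|c xc ch] := @rat_above x h; first by apply: lh; rewrite // inE eqxx.
exists c; split=> // z; rewrite inE => /orP[/eqP->//|/lb]; lra.
Qed.

(** If [a] is some [p i], then [q i] serves. Otherwise the side of [a] on which each [p i] lies
    splits the [q i] strictly, and [b] goes into the gap. *)
Lemma rat_cut (A : lgroupType) (T : eqType) (s : seq T) (p : T -> A)
    (q : T -> rat) (a : A) : totally_ordered A ->
  {in s &, forall i j, (p i <= p j) = (q i <= q j)} ->
  exists b, {in s, forall i, (a <= p i) = (b <= q i) /\
                             (p i <= a) = (q i <= b)}.
Proof.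
move=> Atot pq; have [/hasP[i0 si0 /eqP <-]|] := boolP (has (fun i => p i == a) s).
  by exists (q i0) => i si; rewrite !pq.
move=> /hasPn ne.
have [x y|b [lb bh]] := @rat_between [seq q i | i <- s & p i <= a]
   [seq q i | i <- s & ~~ (p i <= a)].
  move=> /mapP[i]; rewrite mem_filter => /andP[pi si] ->.
  move=> /mapP[j]; rewrite mem_filter => /andP[pj sj] ->.
  rewrite ltNge -pq //; apply: contra pj => /le_trans; exact.
exists b => i si; have := ne _ si; rewrite eq_le.
have := Atot (p i) a; case: (boolP (p i <= a)) => /= [pia _ /negPf->|pia ->//].
  have : q i < b by apply/lb/map_f; rewrite mem_filter pia.
  by move=> /[dup]/ltW->; rewrite ltNge => /negPf->.
have : b < q i by apply/bh/map_f; rewrite mem_filter pia.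
by move=> /[dup]/ltW->; rewrite ltNge => /negPf->.
Qed.

(** * Sign transfer between an ordered divisible group and the rationals *)

Section Transfer.
Variables (A : lgroupType) (Atot : totally_ordered A) (Adiv : divisible A).
Variable V : finType.
Implicit Types (F G : {ffun V -> rat}) (Fs : seq {ffun V -> rat}).
Implicit Types (v : V -> A) (w : V -> rat).

Definition same_sign v w F : Prop :=
  (0 <= lin_eval Adiv v F) = (0 <= rat_eval w F) /\
  (lin_eval Adiv v F <= 0) = (rat_eval w F <= 0).

Definition same_signs v w Fs : Prop := {in Fs, forall F, same_sign v w F}.

Lemma same_sign_scale v w q F : q != 0 -> same_sign v w F ->
  same_sign v w [ffun u => q * F u].
Proof.
rewrite /same_sign lin_eval_scale rat_eval_scale => q0 [h1 h2].
have [q_lt0|q_gt0|q_eq0] := ltgtP q 0; last by rewrite q_eq0 eqxx in q0.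
  by rewrite qscale_nge0 // qscale_nle0 // nmulr_rge0 // nmulr_rle0.
by rewrite qscale_ge0 // qscale_le0 // pmulr_rge0 // pmulr_rle0.
Qed.

Definition free_of u Fs : Prop := {in Fs, forall F : {ffun V -> rat}, F u = 0}.

(** A Fourier-Motzkin step: up to a nonzero factor, a form involving [a] is [a] minus its threshold.
    The signs of the differences of thresholds fix their order, and [rat_cut] then places [b] among
    them. *)
Lemma same_signs_elim1 a Fs : exists Fs',
  [/\ free_of a Fs',
      forall u, free_of u Fs -> free_of u Fs' &
      forall v w, same_signs v w Fs' -> exists b, same_signs v (upd w a b) Fs].
Proof.
pose N := solve_for a.
have Na F : N F a = 0 by rewrite ffunE eqxx.
(* Forms with [F a = 0] also enter the differences, harmlessly, with the zero form as threshold. *)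
exists ([seq F : {ffun V -> rat} <- Fs | F a == 0] ++ [seq N F - N G | F <- Fs, G <- Fs]).
split=> [F|u Fsu F|v w vw].
- rewrite mem_cat mem_filter => /orP[/andP[/eqP//]|/allpairsP[[G H] /= [_ _ ->]]].
  by rewrite !ffunE eqxx subr0.
- rewrite mem_cat mem_filter => /orP[/andP[_ /Fsu//]|/allpairsP[[G H] /=]].
  move=> [GF HF ->]; rewrite !ffunE !Fsu // oppr0 !mul0r.
  by case: eqP => _; rewrite subr0.
have [|b hb] := @rat_cut A _ Fs (lin_eval Adiv v \o N) (rat_eval w \o N) (v a) Atot.
  move=> F G FF GF /=; rewrite -subr_ge0 -lgroup_subr_ge0.
  have [|+ _] := vw (N G - N F).
    by rewrite mem_cat; apply/orP; right; apply/allpairsP; exists (G, F).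
  by rewrite lin_evalD lin_evalN rat_evalD rat_evalN.
exists b => F FF; have [Fa|Fa] := eqVneq (F a) 0.
  have := vw F; rewrite mem_cat mem_filter Fa eqxx FF => /(_ isT).
  by rewrite /same_sign rat_eval_upd.
rewrite (solve_forE Fa); apply: same_sign_scale => //.
rewrite /same_sign lin_evalD lin_evalN lin_eval_var.
rewrite rat_evalD rat_evalN rat_eval_var rat_eval_upd //.
have -> : upd w a b a = b by rewrite /upd eqxx.
have [/= h1 h2] := hb F FF.
rewrite lgroup_subr_ge0 subr_ge0 subr_le0 h2 -h1; split=> //.
by rewrite -lgroup_oppr_ge0 opprB lgroup_subr_ge0.
Qed.

(** Keeping the values of [w] outside [s] makes it possible to solve for some variables while the
    others are prescribed. *)
Lemma same_signs_elim (s : seq V) Fs : exists Fs',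
  [/\ {in s, forall u, free_of u Fs'},
      forall u, free_of u Fs -> free_of u Fs' &
      forall v w, same_signs v w Fs' -> exists w',
        {in predC [in s], w' =1 w} /\ same_signs v w' Fs].
Proof.
elim: s Fs => [|a s IH] Fs; first by exists Fs; split=> // v w; exists w.
have [Fs1 [Fs1a Fs1u Fs1E]] := same_signs_elim1 a Fs.
have [Fs2 [Fs2s Fs2u Fs2E]] := IH Fs1; exists Fs2; split.
- move=> u; rewrite inE => /orP[/eqP->|]; last exact: Fs2s.
  exact: (Fs2u a).
- by move=> u /Fs1u /Fs2u.
move=> v w /Fs2E[w' [ww' /Fs1E[b hb]]]; exists (upd w' a b); split=> // u.
rewrite !inE negb_or => /andP[/negPf ua us]; rewrite /upd ua.
by apply: ww'; rewrite inE.
Qed.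

(** Once every variable is eliminated only the zero form can remain, so any starting point will
    do. *)
Lemma same_signs_exists v Fs : exists w, same_signs v w Fs.
Proof.
have [Fs' [Fs'0 _ Fs'E]] := same_signs_elim (enum V) Fs.
have [|w [_ hw]] := Fs'E v (fun=> 0); last by exists w.
move=> F FF; suff -> : F = 0 by rewrite /same_sign lin_eval0 rat_eval0 !lexx.
by apply/ffunP => u; rewrite ffunE Fs'0 // mem_enum.
Qed.

End Transfer.

(** * Linearity cells of terms *)

Section Cells.
Variable V : finType.
Implicit Types (t u : lterm V) (F : {ffun V -> rat}).
Local Notation cell := ({ffun V -> rat} * seq {ffun V -> rat})%type.

(* A cell (F, G) of t: wherever all forms of G are nonnegative, t equals F. *)
Fixpoint cells (t : lterm V) : seq cell :=
  match t with
  | TVar w => [:: ([ffun u => (u == w)%:R], [::])]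
  | TZero => [:: (0, [::])]
  | TOpp t => [seq (- c.1, c.2) | c : cell <- cells t]
  | TAdd t u =>
    [seq (c.1 + d.1, c.2 ++ d.2) | c : cell <- cells t, d : cell <- cells u]
  | TJoin t u =>
    [seq (c.1, c.1 - d.1 :: c.2 ++ d.2) | c : cell <- cells t, d : cell <- cells u] ++
    [seq (d.1, d.1 - c.1 :: c.2 ++ d.2) | c : cell <- cells t, d : cell <- cells u]
  | TMeet t u =>
    [seq (c.1, d.1 - c.1 :: c.2 ++ d.2) | c : cell <- cells t, d : cell <- cells u] ++
    [seq (d.1, c.1 - d.1 :: c.2 ++ d.2) | c : cell <- cells t, d : cell <- cells u]
  | TFun f _ => match f with end
  end.

(** An equation is imposed as two opposite inequalities between the linear parts of a pair of cells,
    which keeps every cone closed. *)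
Fixpoint cones (phi : seq (lterm V * lterm V)) : seq (seq {ffun V -> rat}) :=
  if phi is e :: phi' then
    [seq G ++ H |
      G <- [seq c.1 - d.1 :: d.1 - c.1 :: c.2 ++ d.2 |
             c : cell <- cells e.1, d : cell <- cells e.2],
      H <- cones phi']
  else [:: [::]].

Variables (A : lgroupType) (Atot : totally_ordered A) (Adiv : divisible A).
Variable v : V -> A.
Local Notation nonneg := (fun F => 0 <= lin_eval Adiv v F).

(** Totality decides at each join or meet which of the two branches applies at [v]. *)
Lemma cells_cover t : exists2 c, c \in cells t & all nonneg c.2.
Proof.
elim: t => [w||t [c ct c0]|t [c ct c0] u [d du d0]|t [c ct c0] u [d du d0]
            |t [c ct c0] u [d du d0]|[]] /=.
- by eexists; first exact: mem_head.
- by eexists; first exact: mem_head.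
- by exists (- c.1, c.2) => //; apply: (map_f (fun c => (- c.1, c.2)) ct).
- exists (c.1 + d.1, c.2 ++ d.2); last by rewrite all_cat c0.
  by apply/allpairsP; exists (c, d).
- case/orP: (Atot (lin_eval Adiv v d.1) (lin_eval Adiv v c.1)) => cd.
    exists (c.1, c.1 - d.1 :: c.2 ++ d.2).
      by rewrite mem_cat; apply/orP; left; apply/allpairsP; exists (c, d).
    by rewrite /= lin_evalD lin_evalN lgroup_subr_ge0 cd all_cat c0.
  exists (d.1, d.1 - c.1 :: c.2 ++ d.2).
    by rewrite mem_cat; apply/orP; right; apply/allpairsP; exists (c, d).
  by rewrite /= lin_evalD lin_evalN lgroup_subr_ge0 cd all_cat c0.
case/orP: (Atot (lin_eval Adiv v d.1) (lin_eval Adiv v c.1)) => cd.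
  exists (d.1, c.1 - d.1 :: c.2 ++ d.2).
    by rewrite mem_cat; apply/orP; right; apply/allpairsP; exists (c, d).
  by rewrite /= lin_evalD lin_evalN lgroup_subr_ge0 cd all_cat c0.
exists (c.1, d.1 - c.1 :: c.2 ++ d.2).
  by rewrite mem_cat; apply/orP; left; apply/allpairsP; exists (c, d).
by rewrite /= lin_evalD lin_evalN lgroup_subr_ge0 cd all_cat c0.
Qed.

Lemma cells_eval t c : c \in cells t -> all nonneg c.2 ->
  leval v t = lin_eval Adiv v c.1.
Proof.
rewrite /leval; elim: t c => [w||t IH|t IHt u IHu|t IHt u IHu|t IHt u IHu|[]] c /=.
- by rewrite inE => /eqP-> _; rewrite lin_eval_var.
- by rewrite inE => /eqP-> _; rewrite lin_eval0.
- by move=> /mapP[d dt ->] /= d0; rewrite lin_evalN (IH d).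
- move=> /allpairsP[[d e] /= [dt eu ->]] /=; rewrite all_cat => /andP[d0 e0].
  by rewrite lin_evalD (IHt d) // (IHu e).
- rewrite mem_cat => /orP[] /allpairsP[[d e] /= [dt eu ->]] /=;
    rewrite lin_evalD lin_evalN lgroup_subr_ge0 all_cat => /and3P[de d0 e0];
    rewrite (IHt d) // (IHu e) //.
    exact: join_l.
  exact: join_r.
rewrite mem_cat => /orP[] /allpairsP[[d e] /= [dt eu ->]] /=;
  rewrite lin_evalD lin_evalN lgroup_subr_ge0 all_cat => /and3P[de d0 e0];
  rewrite (IHt d) // (IHu e) //.
  exact: meet_l.
exact: meet_r.
Qed.

Lemma conesP (phi : seq (lterm V * lterm V)) :
  all (fun e => leval v e.1 == leval v e.2) phi = has (all nonneg) (cones phi).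
Proof.
elim: phi => //= e phi ->; apply/andP/hasP => [[/eqP e12 /hasP[H Hphi H0]]|].
  have [c ct c0] := cells_cover e.1; have [d du d0] := cells_cover e.2.
  exists ((c.1 - d.1 :: d.1 - c.1 :: c.2 ++ d.2) ++ H).
    apply/allpairsP; exists (c.1 - d.1 :: d.1 - c.1 :: c.2 ++ d.2, H).
    by split=> //; apply/allpairsP; exists (c, d).
  rewrite /= !all_cat c0 d0 H0 !lin_evalD !lin_evalN.
  by rewrite -(cells_eval ct c0) -(cells_eval du d0) e12 subrr lexx.
move=> [K /allpairsP[[G H] /= [/allpairsP[[c d] /= [ct du ->]] Hphi ->]]].
rewrite /= !all_cat !lin_evalD !lin_evalN !lgroup_subr_ge0.
move=> /and3P[dc cd /andP[/andP[c0 d0] H0]]; split; last by apply/hasP; exists H.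
by rewrite (cells_eval ct) // (cells_eval du) // eq_le dc cd.
Qed.

End Cells.

(** * Piecewise linear solutions over the rationals *)

(** Induction on the breakpoints: an interval containing [t] is split at [t], and its two halves are
    joined by transitivity. *)
Lemma rat_chain (Bk : seq rat) (R : rat -> rat -> Prop) :
    (forall a b c, a < b -> b < c -> R a b -> R b c -> R a c) ->
    (forall a b, a < b -> (forall t, t \in Bk -> ~~ (a < t < b)) -> R a b) ->
  forall a b, a < b -> R a b.
Proof.
move=> tr; elim: Bk => [|t Bk IH] step; first by move=> a b /step; exact.
apply: IH => a b ab hBk; have [/andP[at_ tb]|ntab] := boolP (a < t < b).
  apply: (tr _ t) => //; apply: step => // s; rewrite inE.
    move=> /orP[/eqP->|/hBk]; first by rewrite ltxx andbF.
    by apply: contra => /andP[-> /lt_trans]; exact.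
  move=> /orP[/eqP->|/hBk]; first by rewrite ltxx.
  by apply: contra => /andP[ts ->]; rewrite (lt_trans at_).
by apply: step => // s; rewrite inE => /orP[/eqP->|/hBk].
Qed.

(** Shrinking the step preserves the constraints already treated. The new one is safe up to
    [a i / (|b i| + 1)], where adding one keeps the denominator positive. *)
Lemma rat_perturb (T : Type) (s : seq T) (a b : T -> rat) :
  exists2 e, 0 < e & all (fun i => (0 < a i) ==> (0 <= a i + e * b i)) s.
Proof.
elim: s => [|i s [e e0 IH]]; first by exists 1.
have shrink d : 0 < d -> d <= e ->
    all (fun i => (0 < a i) ==> (0 <= a i + d * b i)) s.
  move=> d0 de; apply: sub_all IH => j /implyP h; apply/implyP => aj; have := h aj.
  have [bj _|bj] := leP 0 (b j); first by rewrite addr_ge0 ?mulr_ge0 // ltW.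
  by move=> /le_trans; apply; rewrite lerD2l ler_wnM2r // ltW.
have [ai|ai] := boolP (0 < a i); last by exists e; rewrite //= (negPf ai).
have b1 : 0 < `|b i| + 1 by rewrite ltr_wpDl.
exists (Num.min e (a i / (`|b i| + 1))); first by rewrite lt_min e0 divr_gt0.
have d0 : 0 < Num.min e (a i / (`|b i| + 1)) by rewrite lt_min e0 divr_gt0.
rewrite /= shrink ?ge_min ?lexx // andbT ai /=.
set d := Num.min _ _ in d0 *.
have dai : d * (`|b i| + 1) <= a i by rewrite -ler_pdivlMr // ge_min lexx orbT.
have : - `|b i| <= b i by rewrite lerNl -normrN ler_norm.
nra.
Qed.

(** A nonconstant affine function changes sign only at its root [- c / d]. *)
Lemma affine_ge0_of_mid (a b c d : rat) : a < b ->
  ~~ (a < - c / d < b) -> 0 <= c + (a + b) / 2%:R * d ->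
  0 <= c + a * d /\ 0 <= c + b * d.
Proof.
move=> ab; have [->|d0] := eqVneq d 0; first by rewrite !mulr0.
pose r := - c / d; rewrite -/r; have -> : c = - r * d by rewrite /r mulNr divfK // opprK.
rewrite -!mulrDl; have [d_lt0|d_gt0|/eqP] := ltgtP d 0; last by rewrite (negPf d0).
  by rewrite !nmulr_lge0 // => /nandP nr mid; split; case: nr; rewrite -leNgt; lra.
by rewrite !pmulr_lge0 // => /nandP nr mid; split; case: nr; rewrite -leNgt; lra.
Qed.

(** Were the value at [b] nonnegative, the slope would be nonnegative; then the value at 0 would be
    at most 0 and the value at 1 at least 0, against the hypothesis. *)
Lemma affine_lt0 (a b l k : rat) : 0 <= a -> a < b -> b <= 1 ->
  (l <= 0 -> l + k < 0) -> l + a * k <= 0 -> l + b * k < 0.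
Proof.
move=> a0 ab b1 lk la; rewrite ltNge; apply/negP => lb.
have k0 : 0 <= k.
  by rewrite -(@pmulr_rge0 _ (b - a)) ?subr_gt0 // mulrBl; lra.
have ak : 0 <= a * k by rewrite mulr_ge0.
have bk : b * k <= k by rewrite ler_piMl.
lra.
Qed.

(** Meant for a [Q] that quantifies over all rational points, hence excluded middle instead of a
    boolean filter. *)
Lemma classical_filter (T : eqType) (s : seq T) (Q : T -> Prop) :
  exists s' : seq T, forall x, x \in s' <-> x \in s /\ Q x.
Proof.
elim: s => [|y s [s' IH]]; first by exists [::] => x; split=> [|[]].
have [Qy|nQy] := classic (Q y).
  exists (y :: s') => x; rewrite !inE; have := IH x; case: eqP => //= -> _.
  by split.
exists s' => x; rewrite inE; have := IH x; case: eqP => //= -> [h1 h2].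
by split=> [/h1[]//|[_ /nQy]].
Qed.

Section ConeSystems.
Variables n m : nat.
Local Notation V := ('I_n + 'I_m)%type.
Local Notation form := {ffun V -> rat}.
Implicit Types (g : form) (x y : 'cV[rat]_n) (z w : 'cV[rat]_m).

Definition rat_env x z (v : V) : rat :=
  match v with inl i => x i 0 | inr j => z j 0 end.

Definition rat_sat (P : seq (seq form)) x z : bool :=
  has (all (fun g => 0 <= rat_eval (rat_env x z) g)) P.

Lemma rat_eval_env x z g :
  rat_eval (rat_env x z) g =
  \sum_i g (inl i) * x i 0 + \sum_j g (inr j) * z j 0.
Proof. by rewrite /rat_eval big_sumType. Qed.

Lemma rat_eval_envD e x y z w g :
  rat_eval (rat_env (x + e *: y) (z + e *: w)) g =
  rat_eval (rat_env x z) g + e * rat_eval (rat_env y w) g.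
Proof.
rewrite mulr_sumr -big_split; apply: eq_bigr => -[i|i] _; rewrite /= !mxE; ring.
Qed.

Variable P : seq (seq form).
Hypothesis P_ex : forall x, exists z, rat_sat P x z.
Hypothesis P_uniq : forall x z w, rat_sat P x z -> rat_sat P x w -> z = w.

(** If the constraints vanishing at a solution did not determine [z], a short move along a kernel
    direction of their [z]-part would give a second solution at the same [x]. So each cone with a
    subset of its constraints yields one candidate matrix. *)
Lemma pieces : exists Ms : seq 'M[rat]_(m, n),
  forall x z, rat_sat P x z -> exists2 M, M \in Ms & z = M *m x.
Proof.
(* Rows of inactive constraints are zeroed rather than deleted, so the matrix sizes do not depend on
   [I]. *)
pose X (G : seq form) (I : {set 'I_(size G)}) : 'M[rat]_(size G, n) :=
  \matrix_(k, i) (if k \in I then (tnth (in_tuple G) k) (inl i) else 0).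
pose Z (G : seq form) (I : {set 'I_(size G)}) : 'M[rat]_(size G, m) :=
  \matrix_(k, j) (if k \in I then (tnth (in_tuple G) k) (inr j) else 0).
pose sol G (I : {set 'I_(size G)}) := - (pinvmx (Z G I) *m X G I).
exists (flatten [seq [seq sol G J |
  J : {set 'I_(size G)} <- enum {: {set 'I_(size G)}}] | G <- P]).
move=> x z xz; have /hasP[G GP G0] := xz.
pose I := [set k | rat_eval (rat_env x z) (tnth (in_tuple G) k) == 0].
have XZ y w k : k \in I ->
    rat_eval (rat_env y w) (tnth (in_tuple G) k) = (X G I *m y + Z G I *m w) k 0.
  move=> kI; rewrite rat_eval_env !mxE; congr (_ + _); apply: eq_bigr => i _;
  by rewrite mxE kI.
exists (sol G I).
  by apply/flatten_mapP; exists G => //; apply: map_f; rewrite mem_enum.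
have XZ0 : X G I *m x + Z G I *m z = 0.
  apply/colP => k; rewrite [RHS]mxE; have [kI|kI] := boolP (k \in I).
    by rewrite -XZ //; move: kI; rewrite inE => /eqP.
  rewrite !mxE !big1 ?addr0 // => i _; rewrite mxE (negPf kI) mul0r //.
(* Here [row_full] means rank [m], which makes [pinvmx] a left inverse. *)
suff Zfull : row_full (Z G I).
  rewrite /sol mulNmx -mulmxA.
  have -> : X G I *m x = - (Z G I *m z) by apply/eqP; rewrite -addr_eq0 XZ0.
  by rewrite mulmxN opprK mulmxA mulVpmx ?mul1mx.
apply: contraT => Zfull; have : cokermx (Z G I) != 0.
  by rewrite -mxrank_eq0 mxrank_coker subn_eq0 -ltnNge ltn_neqAle rank_leq_col andbT.
move=> /eqP ck; exfalso; apply: ck; apply/matrixP => j0 j; rewrite [RHS]mxE.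
pose d := col j (cokermx (Z G I)).
have Zd : Z G I *m d = 0 by rewrite /d colE mulmxA mulmx_coker mul0mx.
(* Constraint values at the solution and their rates of change along [d]; the step [e] keeps the
   positive ones nonnegative. *)
pose av := rat_eval (rat_env x z); pose bv := rat_eval (rat_env 0 d).
have [e e0 he] := rat_perturb G av bv.
have : rat_sat P x (z + e *: d).
  apply/hasP; exists G => //; apply/allP => g gG.
  rewrite -[x]addr0 -(scaler0 _ e) rat_eval_envD -/(av g) -/(bv g).
  have := allP G0 g gG; rewrite -/(av g) le_eqVlt => /orP[/eqP ag|ag]; last first.
    by have := allP he g gG; rewrite ag.
  have /(nthP 0)[k kG gk] := gG.
  have gE : g = tnth (in_tuple G) (Ordinal kG) by rewrite (tnth_nth 0).
  rewrite /bv gE XZ; first by rewrite mulmx0 add0r Zd mxE mulr0 -gE -ag addr0.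
  by rewrite inE -gE -/(av g) -ag.
move=> /(P_uniq xz)/eqP; rewrite -subr_eq0 opprD addNKr oppr_eq0 scaler_eq0.
by rewrite (gt_eqF e0) /= => /eqP/colP/(_ j0); rewrite !mxE.
Qed.

Section MaxMin.
Variables (Ms : seq 'M[rat]_(m, n)) (i : 'I_m).
Hypothesis MsP : forall x z, rat_sat P x z -> exists2 M, M \in Ms & z = M *m x.

(* If no piece crosses the secant from below, then going along the segment from
   x to y, which consists of finitely many stretches each lying in one piece,
   the solution stays strictly below the secant, which is absurd at y. *)
Lemma crossing_piece x y z w : rat_sat P x z -> rat_sat P y w ->
  exists2 M, M \in Ms & (M *m x) i 0 <= z i 0 /\ w i 0 <= (M *m y) i 0.
Proof.
move=> xz yw; apply: NNPP => none.
have below M : M \in Ms -> (M *m x) i 0 <= z i 0 -> (M *m y) i 0 < w i 0.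
  by move=> MMs Mx; rewrite ltNge; apply/negP => My; apply: none; exists M.
pose p s := x + s *: (y - x).
pose c M g := rat_eval (rat_env x (M *m x)) g.
pose d M g := rat_eval (rat_env (y - x) (M *m (y - x))) g.
have pM (M : 'M_(m, n)) s : M *m p s = M *m x + s *: (M *m (y - x)).
  by rewrite mulmxDr -scalemxAr.
have pE M g s : rat_eval (rat_env (p s) (M *m p s)) g = c M g + s * d M g.
  by rewrite pM rat_eval_envD.
pose sec s := z i 0 + s * (w i 0 - z i 0).
(* A weak bound at [a] and a strict one at [b]: this can start from equality at [x] and still be
   chained. *)
pose R a b := 0 <= a -> b <= 1 ->
  (forall u, rat_sat P (p a) u -> u i 0 <= sec a) ->
  (forall u, rat_sat P (p b) u -> u i 0 < sec b).
suff : R 0 1.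
  move=> /(_ (lexx _) (lexx _)); rewrite /p scale0r addr0 scale1r addrC subrK.
  rewrite /sec mul0r addr0 mul1r addrC subrK => h.
  have hx u : rat_sat P x u -> u i 0 <= z i 0 by move=> /(P_uniq xz)<-.
  by have := h hx w yw; rewrite ltxx.
(* The breakpoints are the parameters at which some constraint, evaluated along some piece,
   vanishes. *)
apply: (@rat_chain [seq - c M g / d M g | M <- Ms, g <- flatten P]) => //.
  move=> a b e ab be Rab Rbe a0 e1 ha; apply: Rbe => //.
  - exact: le_trans a0 (ltW ab).
  by move=> u hu; apply/ltW/Rab => //; exact: le_trans (ltW be) e1.
move=> a b ab noBk a0 b1 ha u hu.
(* The piece valid at the midpoint meets no breakpoint inside the stretch, so it stays valid at both
   ends. *)
have [v hv] := P_ex (p ((a + b) / 2%:R)); have [M MMs vE] := MsP hv.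
move: hv; rewrite vE => /hasP[G GP /allP G0].
have Gab g : g \in G -> 0 <= c M g + a * d M g /\ 0 <= c M g + b * d M g.
  move=> gG; apply: affine_ge0_of_mid => //; last by rewrite -pE G0.
  apply: noBk; apply/allpairsP; exists (M, g); split=> //=.
  by apply/flattenP; exists G.
have ha' : rat_sat P (p a) (M *m p a).
  by apply/hasP; exists G => //; apply/allP => g /Gab[]; rewrite pE.
have hb' : rat_sat P (p b) (M *m p b).
  by apply/hasP; exists G => //; apply/allP => g /Gab[_]; rewrite pE.
rewrite (P_uniq hu hb'); have := ha _ ha'; have := below _ MMs.
rewrite !pM mulmxBr /sec !mxE; set al : rat := (\sum_j _); set be : rat := (\sum_j _).
set zi : rat := z i 0; set wi : rat := w i 0 => hbe; rewrite -subr_le0 -subr_lt0.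
(* The gap between piece and secant at parameter [t] is [al - zi + t * k]; [below] links its signs
   at 0 and 1. *)
set k := (be - al) - (wi - zi).
have secE t : al + t * (be - al) - (zi + t * (wi - zi)) = (al - zi) + t * k.
  by rewrite /k; ring.
rewrite !secE; apply: affine_lt0 => //.
have -> : al - zi + k = be - wi by rewrite /k; ring.
by rewrite subr_le0 subr_lt0.
Qed.

Definition lift_form (l : {ffun 'I_n -> rat}) : form :=
  [ffun v => match v with inl j => l j | inr _ => 0 end].

(** [TT] collects the lists of pieces having, at every point, a member at or below the solution. The
    pieces at or above the solution at a given [y] form such a list, by [crossing_piece]. *)
Lemma rat_max_min : exists TT : seq (seq {ffun 'I_n -> rat}),
  forall x z, rat_sat P x z ->
    (forall K, K \in TT ->
       exists2 l, l \in K & rat_eval (rat_env x z) (lift_form l) <= z i 0) /\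
    (exists2 K, K \in TT &
       {in K, forall l, z i 0 <= rat_eval (rat_env x z) (lift_form l)}).
Proof.
pose rowf (M : 'M[rat]_(m, n)) : {ffun 'I_n -> rat} := [ffun j => M i j].
have rowE M x z : rat_eval (rat_env x z) (lift_form (rowf M)) = (M *m x) i 0.
  rewrite rat_eval_env [X in _ + X]big1 ?addr0 => [|j _]; last by rewrite ffunE mul0r.
  by rewrite mxE; apply: eq_bigr => j _; rewrite !ffunE.
pose Ls := [seq rowf M | M <- Ms].
(* Every filtering of [Ls] is one of its masks, so a finite list of candidates suffices. *)
pose subs := [seq mask (val b) Ls | b <- enum {: (size Ls).-tuple bool}].
have [TT TTE] := classical_filter subs (fun K => forall x z, rat_sat P x z ->
  exists2 l, l \in K & rat_eval (rat_env x z) (lift_form l) <= z i 0).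
exists TT => y w yw; split=> [K /TTE[_]|]; first exact.
pose above l := w i 0 <= rat_eval (rat_env y w) (lift_form l).
exists [seq l <- Ls | above l]; last by move=> l; rewrite mem_filter => /andP[].
apply/TTE; split=> [|x z xz].
  rewrite filter_mask; apply/mapP.
  by exists (map_tuple above (in_tuple Ls)); rewrite ?mem_enum.
have [M MMs [Mx My]] := crossing_piece xz yw.
exists (rowf M); last by rewrite rowE.
by rewrite mem_filter /above rowE My map_f.
Qed.

End MaxMin.

End ConeSystems.

(** * Term functions *)

Section DivisionTerms.
Variables (A : lgroupType) (Adiv : divisible A) (n : nat).
Local Notation dtf := (@division_term_function A Adiv n).
Implicit Types (f g : {ffun 'I_n -> A} -> A).

Lemma dtf_ext f g : f =1 g -> dtf f -> dtf g.
Proof. by move=> fg [t tE]; exists t => x; rewrite -fg. Qed.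

Lemma dtf_var j : dtf (fun x => x j).
Proof. by exists (TVar j). Qed.

Lemma dtf0 : dtf (fun=> 0).
Proof. by exists TZero. Qed.

Lemma dtfN f : dtf f -> dtf (fun x => - f x).
Proof. by move=> [t tE]; exists (TOpp t) => x; rewrite tE. Qed.

Lemma dtfD f g : dtf f -> dtf g -> dtf (fun x => f x + g x).
Proof. by move=> [t tE] [u uE]; exists (TAdd t u) => x; rewrite tE uE. Qed.

Lemma dtf_join f g : dtf f -> dtf g -> dtf (fun x => Order.join (f x) (g x)).
Proof. by move=> [t tE] [u uE]; exists (TJoin t u) => x; rewrite tE uE. Qed.

Lemma dtf_meet f g : dtf f -> dtf g -> dtf (fun x => Order.meet (f x) (g x)).
Proof. by move=> [t tE] [u uE]; exists (TMeet t u) => x; rewrite tE uE. Qed.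

Lemma dtf_mulrn f k : dtf f -> dtf (fun x => f x *+ k).
Proof.
move=> ft; elim: k => [|k IH]; first exact: dtf0.
by apply: dtf_ext (dtfD ft IH) => x; rewrite mulrS.
Qed.

Lemma dtf_qscale q f : dtf f -> dtf (fun x => qscale Adiv q (f x)).
Proof.
move=> ft; have [t tE] : dtf (fun x => f x *~ numq q).
  by case: (numq q) => k; [|apply: dtfN]; apply: dtf_mulrn.
by exists (TFun (exist _ `|denq q|%N (absz_denq_gt0 q)) t) => x /=; rewrite -tE.
Qed.

Lemma dtf_lin_eval l : dtf (fun x : {ffun 'I_n -> A} => lin_eval Adiv x l).
Proof.
rewrite /lin_eval; elim: (index_enum _) => [|j s IH].
  by apply: dtf_ext dtf0 => x; rewrite big_nil.
apply: dtf_ext (dtfD (dtf_qscale (l j) (dtf_var j)) IH) => x.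
by rewrite big_cons.
Qed.

(** The meet of [K] is described by its lower bounds; an empty meet would have to be a top
    element. *)
Lemma dtf_min (K : seq {ffun 'I_n -> rat}) : K != [::] -> exists2 f, dtf f &
  forall (x : {ffun 'I_n -> A}) c, (c <= f x) = all (fun l => c <= lin_eval Adiv x l) K.
Proof.
elim: K => // l [_ _|l' K /(_ isT)[f ft fE] _].
  exists (fun x : {ffun 'I_n -> A} => lin_eval Adiv x l) => [|x c].
    exact: dtf_lin_eval.
  by rewrite /= andbT.
exists (fun x : {ffun 'I_n -> A} => Order.meet (lin_eval Adiv x l) (f x)).
  exact: dtf_meet (dtf_lin_eval l) ft.
by move=> x c; rewrite lexI fE.
Qed.

(** For the join of the meets, the two clauses taken at the same [c] force [f x = c]. *)
Lemma dtf_max_min (TT : seq (seq {ffun 'I_n -> rat})) :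
    TT != [::] -> [::] \notin TT -> exists2 f, dtf f & forall (x : {ffun 'I_n -> A}) c,
  ((forall K, K \in TT -> exists2 l, l \in K & lin_eval Adiv x l <= c) ->
     f x <= c) /\
  ((exists2 K, K \in TT & {in K, forall l, c <= lin_eval Adiv x l}) ->
     c <= f x).
Proof.
have min_le K (f : {ffun 'I_n -> A} -> A) (x : {ffun 'I_n -> A}) c :
    (forall (x : {ffun 'I_n -> A}) c, (c <= f x) =
    all (fun l => c <= lin_eval Adiv x l) K) ->
    (exists2 l, l \in K & lin_eval Adiv x l <= c) -> f x <= c.
  move=> fE [l lK]; apply: le_trans; have := lexx (f x); rewrite fE.
  by move=> /allP; exact.
elim: TT => // K TT IH _; rewrite inE negb_or eq_sym => /andP[K0 TT0].
have [f ft fE] := dtf_min K0; have [TTnil|TTn] := eqVneq TT [::].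
  exists f => // x c; rewrite TTnil; split=> [h|[K' /[!inE]/eqP-> h]].
    by apply: (min_le K) => //; apply: h; rewrite inE eqxx.
  by rewrite fE; apply/allP.
have [g gt gE] := IH TTn TT0; exists (fun x : {ffun 'I_n -> A} => Order.join (f x) (g x)).
  exact: dtf_join.
move=> x c; have [g1 g2] := gE x c; split=> [h|[K' /[!inE]/orP[/eqP->|KT] h]].
- rewrite leUx (min_le K) ?g1 // => [K' KT|]; apply: h; rewrite inE ?eqxx //.
  by rewrite KT orbT.
- by rewrite lexU2 // fE; apply/orP; left; apply/allP.
by rewrite lexU2 // g2 ?orbT //; exists K'.
Qed.

End DivisionTerms.

(** * Embedding the rationals along a positive element *)

Section Scaling.
Variables (A : lgroupType) (Adiv : divisible A) (d : A).
Hypothesis d_gt0 : 0 < d.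

Lemma qscale_gt0_ge0 q : (0 <= qscale Adiv q d) = (0 <= q).
Proof.
have [q_lt0|q_gt0|->] := ltgtP q 0; last by rewrite qscale0l lexx.
  by rewrite qscale_nge0 // lt_geF.
by rewrite qscale_ge0 // ltW.
Qed.

Lemma qscale_gt0_le0 q : (qscale Adiv q d <= 0) = (q <= 0).
Proof. by rewrite -lgroup_oppr_ge0 -qscaleNl qscale_gt0_ge0 oppr_ge0. Qed.

Lemma qscale_gt0_inj : injective (fun q => qscale Adiv q d).
Proof.
move=> p q /eqP; rewrite -subr_eq0 -qscaleNl -qscaleDl eq_le.
by rewrite qscale_gt0_ge0 qscale_gt0_le0 -eq_le subr_eq0 => /eqP.
Qed.

Lemma lin_eval_qscale (V : finType) (v : V -> rat) F :
  lin_eval Adiv (fun u => qscale Adiv (v u) d) F = qscale Adiv (rat_eval v F) d.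
Proof.
rewrite /rat_eval (big_morph (fun q => qscale Adiv q d) (id1 := 0)
  (fun p q => qscaleDl Adiv p q d) (qscale0l Adiv d)).
by apply: eq_bigr => u _; rewrite qscaleA.
Qed.

End Scaling.

Lemma same_signs_has (A : lgroupType) (Adiv : divisible A) (V : finType)
    (v : V -> A) (w : V -> rat) (P : seq (seq {ffun V -> rat})) :
  same_signs Adiv v w (flatten P) ->
  has (all (fun F => 0 <= lin_eval Adiv v F)) P =
  has (all (fun F => 0 <= rat_eval w F)) P.
Proof.
move=> vw; apply: eq_in_has => G GP; apply: eq_in_all => F FG.
by have [] := vw F; first by apply/flattenP; exists G.
Qed.

(** * Transfer of the system to the rationals and back *)

Section EfdCones.
Variables (A : lgroupType) (Atot : totally_ordered A) (Adiv : divisible A).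
Variables (n m : nat) (phi : efd n m) (phiA : efd_holds A phi).

Lemma efd_sat_cones (x : {ffun 'I_n -> A}) (z : {ffun 'I_m -> A}) :
  efd_sat phi x z =
  has (all (fun F => 0 <= lin_eval Adiv (efd_env x z) F)) (cones phi).
Proof. exact: conesP. Qed.

Lemma lin_eval_lift_form (x : {ffun 'I_n -> A}) (z : {ffun 'I_m -> A}) l :
  lin_eval Adiv (efd_env x z) (lift_form m l) = lin_eval Adiv x l.
Proof.
rewrite /lin_eval big_sumType /= [X in _ + X]big1 ?addr0 => [|j _].
  by apply: eq_bigr => j _; rewrite ffunE.
by rewrite ffunE qscale0l.
Qed.

Variables (d : A) (d_gt0 : 0 < d).

(** The system is solved in the group at the image of [x]. Eliminating only the [z] variables leaves
    forms in [x], whose signs the embedding preserves, and this produces a rational solution at [x]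
    itself. *)
Lemma efd_rat_ex (x : 'cV[rat]_n) : exists z, rat_sat (cones phi) x z.
Proof.
pose xd := [ffun j => qscale Adiv (x j 0) d].
have := (efd_funP phiA xd _).2 erefl; set zd := efd_fun _ _; rewrite efd_sat_cones.
have [Fs [Fs0 _ FsE]] := same_signs_elim Atot Adiv
  [seq inr j | j <- enum 'I_m] (flatten (cones phi)).
(* The [0] is a placeholder for [z], on which the forms of [Fs] do not depend. *)
have [|w [wx ww]] := FsE (efd_env xd zd) (rat_env x 0).
  move=> F FFs; rewrite /same_sign.
  suff -> : lin_eval Adiv (efd_env xd zd) F =
      qscale Adiv (rat_eval (rat_env x 0) F) d.
    by rewrite qscale_gt0_ge0 ?qscale_gt0_le0.
  rewrite -lin_eval_qscale; apply: eq_bigr => -[j|j] _; first by rewrite /= ffunE.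
  by rewrite (Fs0 (inr j)) ?qscale0l // map_f ?mem_enum.
rewrite (same_signs_has ww) => sat; exists (\col_j w (inr j)).
apply: etrans sat; apply: eq_has => G; apply: eq_all => F; congr (0 <= _).
apply: eq_bigr => -[j|j] _; congr (_ * _); rewrite /= ?mxE // wx // inE.
by apply/mapP => -[].
Qed.

(** The embedding along [d] is linear, sign-preserving and injective, so two rational solutions
    would give two in the group. *)
Lemma efd_rat_uniq (x : 'cV[rat]_n) z w :
  rat_sat (cones phi) x z -> rat_sat (cones phi) x w -> z = w.
Proof.
pose xd := [ffun j => qscale Adiv (x j 0) d].
pose sd (z : 'cV[rat]_m) := [ffun j => qscale Adiv (z j 0) d].
have sat u : rat_sat (cones phi) x u -> efd_fun phiA xd = sd u.
  move=> xu; apply/efd_funP; rewrite efd_sat_cones.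
  rewrite (@same_signs_has _ _ _ _ (rat_env x u)) // => F _; rewrite /same_sign.
  suff -> : lin_eval Adiv (efd_env xd (sd u)) F =
      qscale Adiv (rat_eval (rat_env x u) F) d.
    by rewrite qscale_gt0_ge0 ?qscale_gt0_le0.
  by rewrite -lin_eval_qscale; apply: eq_bigr => -[j|j] _; rewrite /= ffunE.
move=> /sat zE /sat; rewrite zE => /ffunP zw; apply/colP => j.
by have := zw j; rewrite !ffunE => /(qscale_gt0_inj d_gt0).
Qed.

(** At each [x], a rational point is chosen with the same signs for the cone constraints and for all
    differences [D l] between a piece and the [i]-th output; the rational description is then read
    back. *)
Lemma efd_max_min (i : 'I_m) : exists TT : seq (seq {ffun 'I_n -> rat}),
  forall x : {ffun 'I_n -> A},
    (forall K, K \in TT ->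
       exists2 l, l \in K & lin_eval Adiv x l <= efd_fun phiA x i) /\
    (exists2 K, K \in TT &
       {in K, forall l, efd_fun phiA x i <= lin_eval Adiv x l}).
Proof.
have [Ms MsP] := pieces efd_rat_uniq.
have [TT TTE] := rat_max_min efd_rat_ex efd_rat_uniq i MsP; exists TT => x.
set z := efd_fun phiA x; have : efd_sat phi x z by apply/efd_funP.
pose D l : {ffun 'I_n + 'I_m -> rat} :=
  lift_form m l - [ffun u => (u == inr i)%:R].
have [w ww] := same_signs_exists Atot Adiv (efd_env x z)
  (flatten (cones phi) ++ [seq D l | l <- flatten TT]).
rewrite efd_sat_cones (same_signs_has (w := w)); last first.
  by move=> F FF; apply: ww; rewrite mem_cat FF.
pose wx : 'cV[rat]_n := \col_j w (inl j); pose wz : 'cV[rat]_m := \col_j w (inr j).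
have wE F : rat_eval w F = rat_eval (rat_env wx wz) F.
  by apply: eq_bigr => -[j|j] _; rewrite /= mxE.
move=> sat; have : rat_sat (cones phi) wx wz.
  by apply: etrans sat; apply: eq_has => G; apply: eq_all => F; rewrite wE.
have sign K l : K \in TT -> l \in K ->
    (z i <= lin_eval Adiv x l) =
      (wz i 0 <= rat_eval (rat_env wx wz) (lift_form m l)) /\
    (lin_eval Adiv x l <= z i) =
      (rat_eval (rat_env wx wz) (lift_form m l) <= wz i 0).
  move=> KT lK; have [|] := ww (D l).
    by rewrite mem_cat; apply/orP; right; apply: map_f; apply/flattenP; exists K.
  rewrite wE lin_evalD lin_evalN lin_eval_var lin_eval_lift_form.
  rewrite rat_evalD rat_evalN rat_eval_var /= lgroup_subr_ge0 subr_ge0 subr_le0.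
  by rewrite -lgroup_oppr_ge0 opprB lgroup_subr_ge0 => -> ->.
move=> /TTE[lo [K KT hi]]; split=> [K' KT'|].
  by have [l lK ll] := lo _ KT'; exists l => //; rewrite (sign _ _ KT' lK).2.
by exists K => // l lK; rewrite (sign _ _ KT lK).1 hi.
Qed.

End EfdCones.

Theorem theorem4p3 (D : lgroupType) (Dtot : totally_ordered D)
    (Ddiv : divisible D) (n m : nat) (m_gt0 : (0 < m)%N) (phi : efd n m)
    (phiD : efd_holds D phi) :
  forall i : 'I_m, division_term_function Ddiv (efd_coord phiD i).
Proof.
(* Without a positive element, totality makes the group trivial and the constant zero term works. *)
move=> i; have [[d d_gt0]|triv] := classic (exists d : D, 0 < d); last first.
  have all0 (a : D) : a = 0.
    apply/eqP; apply: contraT => a0; case: triv.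
    case/orP: (Dtot a 0) => [a_le|a_ge]; [exists (- a)|exists a].
      by rewrite lt_neqAle eq_sym oppr_eq0 a0 lgroup_oppr_ge0.
    by rewrite lt_neqAle eq_sym a0.
  by exists TZero => x; rewrite [LHS]all0.
have [TT TTE] := efd_max_min Dtot Ddiv phiD d_gt0 i.
(* Evaluating at one point shows that [TT] is nonempty and has no empty member. *)
have [lo0 [K0 K0T _]] := TTE 0.
have [| |f ft fE] := @dtf_max_min _ Ddiv _ TT.
- by apply: contraTneq K0T => ->.
- by apply/negP => /lo0[].
apply: dtf_ext ft => x; have [lo hi] := TTE x.
by have [f1 f2] := fE x (efd_fun phiD x i); apply/le_anti; rewrite f1 // f2.
Qed.
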